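(* Let $(A,\circ)$ be a pre-Lie algebra. Suppose that $\triangleleft:A\otimes A\rightarrow A$ is an antisymmetric multiplication on $A$. Define a multiplication $\triangleright$ on $A$ by $x\triangleright y= x\circ y-x\triangleleft y$ for all $x,y\in A$. Then the following statements are equivalent. (a) $(A,\triangleright,\triangleleft)$ is a special L-dendriform algebra. (b) The following equation holds: $$x\triangleleft(y\triangleleft z)+y\triangleleft(x\circ z)-z\triangleleft(x\circ y)-x\circ(y\triangleleft z)=0,\quad\forall x,y,z\in A.$$ (c) $(A,\mathcal{L}_{\circ}-\mathcal{L}_{\triangleleft},-\mathcal{L}_{\triangleleft})$ is a representation of $(A,\circ)$. (d) $(A^{*},\mathcal{L}^{*}_{\circ},\mathcal{L}^{*}_{\triangleleft})$ is a representation of $(A,\circ)$.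
   Context: All vector spaces and algebras are finite-dimensional over a field of characteristic zero. A pre-Lie algebra is a vector space $A$ with a bilinear operation $\circ$ such that $(x\circ y)\circ z-x\circ(y\circ z)=(y\circ x)\circ z-y\circ(x\circ z)$. An L-dendriform algebra $(A,\triangleright,\triangleleft)$ is a vector space with two bilinear operations satisfying $(x\triangleright y)\triangleright z+(x\triangleleft y)\triangleright z+y\triangleright(x\triangleright z)-(y\triangleleft x)\triangleright z-(y\triangleright x)\triangleright z-x\triangleright(y\triangleright z)=0$ and $(x\triangleright y)\triangleleft z+y\triangleleft(x\triangleright z)+y\triangleleft(x\triangleleft z)-(y\triangleleft x)\triangleleft z-x\triangleright(y\triangleleft z)=0$ for all $x,y,z\in A$; it is special if $\triangleleft$ is antisymmetric ($x\triangleleft y=-y\triangleleft x$). A representation of a pre-Lie algebra $(A,\circ)$ is a triple $(V,l,r)$ with $V$ a vector space and $l,r:A\to\mathrm{End}(V)$ linear such that for all $x,y\in A$, $v\in V$: $l(x)l(y)v-l(x\circ y)v=l(y)l(x)v-l(y\circ x)v$ and $l(x)r(y)v-r(y)l(x)v=r(x\circ y)v-r(y)r(x)v$. $\mathcal{L}_{\circ}(x)y=x\circ y$, $\mathcal{L}_{\triangleleft}(x)y=x\triangleleft y$. For a linear map $\rho:A\to\mathrm{End}(V)$, $\rho^*:A\to\mathrm{End}(V^* )$ is given by $\langle\rho^*(x)v^*,u\rangle=-\langle v^*,\rho(x)u\rangle$. *)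

(* Defs.v *)
From HB Require Import structures.
From mathcomp Require Import all_boot all_algebra.

Set Implicit Arguments.
Unset Strict Implicit.
Unset Printing Implicit Defensive.

Import GRing.Theory.
Local Open Scope ring_scope.

Section Algebras.
Variables (F : fieldType) (A : vectType F).
Implicit Types circ rtri ltri mul : {bilinear A -> A -> A}.

Definition pre_Lie circ : Prop := forall x y z,
  circ (circ x y) z - circ x (circ y z) = circ (circ y x) z - circ y (circ x z).

Definition antisymmetric_mul mul : Prop := forall x y, mul x y = - mul y x.

Definition L_dendriform rtri ltri : Prop :=
  (forall x y z,
     rtri (rtri x y) z + rtri (ltri x y) z + rtri y (rtri x z)
     - rtri (ltri y x) z - rtri (rtri y x) z - rtri x (rtri y z) = 0) /\
  (forall x y z,
     ltri (rtri x y) z + ltri y (rtri x z) + ltri y (ltri x z)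
     - ltri (ltri y x) z - rtri x (ltri y z) = 0).

Definition special_L_dendriform rtri ltri : Prop :=
  L_dendriform rtri ltri /\ antisymmetric_mul ltri.

Definition sub_mul (m1 m2 : {bilinear A -> A -> A}) (x y : A) : A :=
  m1 x y - m2 x y.

Fact sub_mul_is_bilinear m1 m2 : bilinear_for *:%R *:%R (sub_mul m1 m2).
Proof.
by split=> u a x y; rewrite /sub_mul ?linearPl ?linearPr /= opprD addrACA scalerBr.
Qed.

HB.instance Definition _ m1 m2 :=
  bilinear_isBilinear.Build F A A A *:%R *:%R (sub_mul m1 m2)
    (sub_mul_is_bilinear m1 m2).

Definition left_mul_at mul (x : A) : 'End(A) := linfun (mul x).

Fact left_mul_at_is_linear mul : linear (left_mul_at mul).
Proof.
move=> a x y; apply/lfunP=> z.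
by rewrite add_lfunE scale_lfunE !(lfunE (mul _)); exact: (linearPl mul).
Qed.

HB.instance Definition _ mul :=
  GRing.isLinear.Build F A 'End(A) *:%R (left_mul_at mul)
    (left_mul_at_is_linear mul).

Definition left_mul mul : 'Hom(A, 'End(A)) := linfun (left_mul_at mul).

Lemma left_mulE mul x y : left_mul mul x y = mul x y.
Proof. by rewrite lfunE lfunE. Qed.

Definition pre_Lie_rep circ (V : vectType F) (l r : 'Hom(A, 'End(V))) : Prop :=
  forall (x y : A) (v : V),
    l x (l y v) - l (circ x y) v = l y (l x v) - l (circ y x) v /\
    l x (r y v) - r y (l x v) = r (circ x y) v - r y (r x v).

End Algebras.

Section Dual.
Variables (F : fieldType) (V : vectType F).

Definition dual_space : vectType F := 'Hom(V, F^o).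

Definition neg_precomp (g : 'End(V)) (f : dual_space) : dual_space :=
  (- (f \o g))%VF.

Lemma neg_precompE g f u : neg_precomp g f u = - f (g u).
Proof. by rewrite opp_lfunE comp_lfunE. Qed.

Fact neg_precomp_is_linear g : linear (neg_precomp g).
Proof.
move=> a f1 f2; apply/lfunP=> u.
by rewrite add_lfunE scale_lfunE !neg_precompE add_lfunE scale_lfunE opprD scalerN.
Qed.

HB.instance Definition _ g :=
  GRing.isLinear.Build F dual_space dual_space *:%R (neg_precomp g)
    (neg_precomp_is_linear g).

Definition neg_transpose (g : 'End(V)) : 'End(dual_space) :=
  linfun (neg_precomp g).

Lemma neg_transposeE g f u : neg_transpose g f u = - f (g u).
Proof. by rewrite lfunE neg_precompE. Qed.

Fact neg_transpose_is_linear : linear neg_transpose.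
Proof.
move=> a g1 g2; apply/lfunP=> f; apply/lfunP=> u.
rewrite add_lfunE scale_lfunE add_lfunE scale_lfunE !neg_transposeE.
by rewrite add_lfunE scale_lfunE linearP opprD scalerN.
Qed.

HB.instance Definition _ :=
  GRing.isLinear.Build F 'End(V) 'End(dual_space) *:%R neg_transpose
    neg_transpose_is_linear.

Definition dual_rep (A : vectType F) (rho : 'Hom(A, 'End(V))) :
    'Hom(A, 'End(dual_space)) :=
  (linfun neg_transpose \o rho)%VF.

Lemma dual_repE (A : vectType F) (rho : 'Hom(A, 'End(V))) x (f : dual_space) u :
  dual_rep rho x f u = - f (rho x u).
Proof. by rewrite comp_lfunE (lfunE neg_transpose) neg_transposeE. Qed.

End Dual.

(* Main.v *)
Require Import Defs.
From mathcomp Require Import all_boot all_algebra.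
From mathcomp Require Import ring.

Import GRing.Theory.
Local Open Scope ring_scope.

(** Write [E x y z] for the left-hand side of (b). Expanding by bilinearity and
using that [ltri] is antisymmetric and [circ] pre-Lie, the two axioms of an
L-dendriform algebra read [E y x z - E x y z = 0] and [E x y z = 0], and so do
the two axioms of the representation in (c). The first axiom of the
representation in (d) is the pre-Lie identity, and the second one, evaluated at
[f] in the dual space, reads [f (E x y u) = 0]. *)

Section LinearForms.
Variables (F : fieldType) (V : vectType F).

(** A vector is determined by its coordinates in a basis, and each coordinate is a linear form. *)
Lemma dual_space_sep (u v : V) :
  (forall f : dual_space V, f u = f v :> F) -> u = v.
Proof.
move=> uv; rewrite (coord_vbasis (memvf u)) (coord_vbasis (memvf v)).
apply: eq_bigr => i _; congr (_ *: _).
by have := uv (linfun (coord (vbasis fullv) i : V -> F^o)); rewrite !lfunE.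
Qed.

(* Plain functions into [F] avoid the structures on [F^o], on which rewriting with
   the linearity of [f : dual_space V] and [ring] do not terminate. *)
Lemma additive_form_sep (u v : V) :
  (forall f : V -> F, {morph f : x y / x + y} -> {morph f : x / - x} ->
    f u = f v) ->
  u = v.
Proof.
move=> uv; apply: dual_space_sep => f.
by apply: (uv f) => [x y | x]; rewrite (linearD, linearN).
Qed.

End LinearForms.

Section Obstruction.
Variables (F : fieldType) (A : vectType F) (circ ltri : {bilinear A -> A -> A}).
Hypotheses (circ_pre_Lie : pre_Lie circ) (ltri_anti : antisymmetric_mul ltri).

Definition obstruction (x y z : A) : A :=
  ltri x (ltri y z) + ltri y (circ x z) - ltri z (circ x y) - circ x (ltri y z).

Local Notation E := obstruction.
Local Notation rtri := (sub_mul circ ltri).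

(* Additive forms separate points, so identities in the vector space [A] can be
   checked by [ring] in [F]. *)
Local Ltac by_additive_forms :=
  let f := fresh "f" in let fD := fresh "fD" in let fN := fresh "fN" in
  apply: additive_form_sep => f fD fN; rewrite !(fD, fN); ring.

(** The left-hand side is the defect of the first axiom in (c), where the left action is [rtri]. The
    terms involving [circ] alone cancel by the pre-Lie identity. *)
Lemma obstruction_swap x y z :
  rtri x (rtri y z) - rtri (circ x y) z
  - (rtri y (rtri x z) - rtri (circ y x) z) = E x y z - E y x z.
Proof.
have /(canRL (subrK _)) pL := circ_pre_Lie x y z.
rewrite /E /sub_mul !linearB /= pL (ltri_anti z (circ x y)).
rewrite (ltri_anti z (circ y x)); by_additive_forms.
Qed.

(** As [rtri] and [ltri] add up to [circ], the terms regroup into [obstruction_swap] with [x] and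
    [y] exchanged. *)
Lemma L_dendriform1E x y z :
  rtri (rtri x y) z + rtri (ltri x y) z + rtri y (rtri x z)
  - rtri (ltri y x) z - rtri (rtri y x) z - rtri x (rtri y z)
  = E y x z - E x y z.
Proof.
have circE u v : circ u v = rtri u v + ltri u v by rewrite subrK.
rewrite -obstruction_swap !(circE x y) !(circE y x).
rewrite !(linearDl (sub_mul circ ltri)) /=; by_additive_forms.
Qed.

(** The part [- ltri (ltri x y) z] of the first term cancels [- ltri (ltri y x) z] by
    antisymmetry. *)
Lemma L_dendriform2E x y z :
  ltri (rtri x y) z + ltri y (rtri x z) + ltri y (ltri x z)
  - ltri (ltri y x) z - rtri x (ltri y z) = E x y z.
Proof.
rewrite /E /sub_mul (ltri_anti y x) (ltri_anti z (circ x y)).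
rewrite !(linearBl ltri) !(linearNl ltri) !(linearBr ltri) /=; by_additive_forms.
Qed.

Lemma special_L_dendriformP :
  special_L_dendriform rtri ltri <-> forall x y z, E x y z = 0.
Proof.
split=> [[[_ L2] _] x y z | E0]; first by have := L2 x y z; rewrite L_dendriform2E.
split; last exact: ltri_anti.
split=> x y z; last by rewrite L_dendriform2E.
by rewrite L_dendriform1E !E0 subrr.
Qed.

Lemma left_mul_rep2E x y v :
  rtri x (- ltri y v) + ltri y (rtri x v)
  - (- ltri (circ x y) v - ltri y (ltri x v)) = E x y v.
Proof.
rewrite /E /sub_mul (ltri_anti v (circ x y)).
rewrite !(linearBr ltri) !(linearNr circ, linearNr ltri) /=; by_additive_forms.
Qed.

Lemma left_mul_repP :
  pre_Lie_rep circ (left_mul circ - left_mul ltri) (- left_mul ltri)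
  <-> forall x y z, E x y z = 0.
Proof.
have lE x v : (left_mul circ - left_mul ltri) x v = rtri x v.
  by rewrite add_lfunE opp_lfunE add_lfunE opp_lfunE !left_mulE.
have rE x v : (- left_mul ltri) x v = - ltri x v.
  by rewrite opp_lfunE opp_lfunE left_mulE.
have rrE x y v : - ltri x (- ltri y v) = ltri x (ltri y v).
  by rewrite linearNr opprK.
split=> [rep x y v | E0 x y v].
  have [_] := rep x y v; rewrite !(lE, rE) rrE opprK => /eqP.
  by rewrite -subr_eq0 left_mul_rep2E => /eqP.
rewrite !(lE, rE) rrE opprK; split; apply/eqP; rewrite -subr_eq0.
  by rewrite obstruction_swap !E0 subrr.
by rewrite left_mul_rep2E E0.
Qed.

(** Transposing reverses composition: two successive dual actions contribute sign [+], a single one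
    [-]. *)
Lemma dual_left_mul_rep2E x y (f : dual_space A) u :
  (dual_rep (left_mul circ) x (dual_rep (left_mul ltri) y f)
   - dual_rep (left_mul ltri) y (dual_rep (left_mul circ) x f)
   - (dual_rep (left_mul ltri) (circ x y) f
      - dual_rep (left_mul ltri) y (dual_rep (left_mul ltri) x f))) u
  = f (E x y u).
Proof.
rewrite !(add_lfunE, opp_lfunE) !dual_repE !left_mulE.
suff fE (g : A -> F) : {morph g : v w / v + w} -> {morph g : v / - v} ->
    - - g (ltri y (circ x u)) - - - g (circ x (ltri y u))
    - (- g (ltri (circ x y) u) - - - g (ltri x (ltri y u))) = g (E x y u).
  by apply: fE => [v w | v]; rewrite (linearD, linearN).
by move=> gD gN; rewrite /E (ltri_anti u (circ x y)) !(gD, gN); ring.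
Qed.

Lemma dual_left_mul_repP :
  pre_Lie_rep circ (dual_rep (left_mul circ)) (dual_rep (left_mul ltri))
  <-> forall x y z, E x y z = 0.
Proof.
split=> [rep x y u | E0 x y f].
  apply: dual_space_sep => f; have [_ /eqP] := rep x y f.
  by rewrite -subr_eq0 -dual_left_mul_rep2E linear0 => /eqP->; rewrite lfunE.
split; last first.
  apply/eqP; rewrite -subr_eq0; apply/eqP/lfunP=> u.
  by rewrite dual_left_mul_rep2E E0 linear0 lfunE.
apply/lfunP=> u; rewrite !(add_lfunE, opp_lfunE) !dual_repE !left_mulE.
(* The pre-Lie identity is solved for [circ (circ x y) u] to serve as a rewrite rule under [f]. *)
have /(canRL (subrK _)) -> := circ_pre_Lie x y u.
suff fE (g : A -> F) : {morph g : v w / v + w} -> {morph g : v / - v} ->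
    - - g (circ y (circ x u))
    - - g (circ (circ y x) u - circ y (circ x u) + circ x (circ y u))
    = - - g (circ x (circ y u)) - - g (circ (circ y x) u).
  by apply: fE => [v w | v]; rewrite (linearD, linearN).
by move=> gD gN; rewrite !(gD, gN); ring.
Qed.

End Obstruction.

Theorem proposition2p17 (F : fieldType) (charF0 : [pchar F] =i pred0)
    (A : vectType F) (circ ltri : {bilinear A -> A -> A})
    (circ_pre_Lie : pre_Lie circ) (ltri_anti : antisymmetric_mul ltri) :
  [<-> (* (a) *) special_L_dendriform (sub_mul circ ltri) ltri;
       (* (b) *) forall x y z : A,
         ltri x (ltri y z) + ltri y (circ x z) - ltri z (circ x y)
         - circ x (ltri y z) = 0;
       (* (c) *) pre_Lie_rep circ (left_mul circ - left_mul ltri) (- left_mul ltri);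
       (* (d) *) pre_Lie_rep circ (dual_rep (left_mul circ))
                   (dual_rep (left_mul ltri))].
Proof.
have aP := special_L_dendriformP _ _ _ _ circ_pre_Lie ltri_anti.
have cP := left_mul_repP _ _ _ _ circ_pre_Lie ltri_anti.
have dP := dual_left_mul_repP _ _ _ _ circ_pre_Lie ltri_anti.
(* Statement (b) is the vanishing of [obstruction] up to unfolding; the other two implications pass
   through it. *)
tfae; [exact: (proj1 aP) | exact: (proj2 cP) | |].
- by move=> /cP /dP.
- by move=> /dP /aP.
Qed.
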